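(* Let $m,t$ be positive integers with $m\ge t$, and define \[ \psi(m,t)=\begin{cases} \lfloor m/(2t)\rfloor+1 & \text{if } m \text{ is even},\\ \left\lceil \tfrac12\lfloor m/t\rfloor\right\rceil & \text{if } m \text{ is odd}.\end{cases} \] Then there is a constant $C=C(m,t)$ such that for every integer $n\ge m$, every latin square of order $n$ has at most $C\,n^{\psi(m,t)+t}$ subsquares of order $m$.
   Context: A latin square of order $n$ is an $n\times n$ matrix on $n$ symbols in which each symbol occurs exactly once in each row and each column. A subsquare of a latin square $L$ is a submatrix of $L$ (obtained by selecting some set of rows and some set of columns, not necessarily contiguous) that is itself a latin square; its order is its number of rows. *)

(* Defs.v *)
From mathcomp Require Import all_boot all_order all_algebra.
Set Implicit Arguments.
Unset Strict Implicit.
Unset Printing Implicit Defensive.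

Definition symbols (S : finType) (p q : nat) (A : 'M[S]_(p, q)) : {set S} :=
  [set A i j | i : 'I_p, j : 'I_q].

(* The two dimensions are kept separate, and required to be equal, so that the
   same predicate applies to submatrices, whose dimensions are cardinals. The
   symbols are those that occur: [S] may have further, unused elements. *)
Definition latin_square (S : finType) (p q : nat) (A : 'M[S]_(p, q)) : bool :=
  [&& p == q,
      #|symbols A| == p,
      [forall i : 'I_p, forall s in symbols A, #|[set j | A i j == s]| == 1]
    & [forall j : 'I_q, forall s in symbols A, #|[set i | A i j == s]| == 1]].

Definition submatrix (S : finType) (n : nat) (L : 'M[S]_n)
    (R C : {set 'I_n}) : 'M[S]_(#|R|, #|C|) :=
  mxsub (@enum_val _ (mem R)) (@enum_val _ (mem C)) L.

(* A subsquare is identified with its pair (row set, column set). *)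
Definition subsquares (S : finType) (n : nat) (L : 'M[S]_n) (m : nat) :
    {set {set 'I_n} * {set 'I_n}} :=
  [set RC : {set 'I_n} * {set 'I_n} |
    (#|RC.1| == m) && latin_square (submatrix L RC.1 RC.2)].

(* [uphalf k] is the ceiling of k / 2. *)
Definition psi (m t : nat) : nat :=
  if odd m then uphalf (m %/ t) else m %/ (2 * t) + 1.

(* Main.v *)
(** Fix t rows of a subsquare of order m. Joining two columns when they share a
    symbol within these rows splits the columns of the subsquare into at most
    m / t blocks, since a block contains at least t columns. By averaging,
    psi m t of the blocks cover more than half of the columns. Two subsquares of
    order m that share a row and more than half of their columns coincide, so the
    t rows and one column from each chosen block determine the subsquare. *)
Require Import Defs.
From mathcomp Require Import all_boot all_order all_algebra.
From mathcomp Require Import zify.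

(** * Counting by keys and averaging over finite sets *)

Lemma leq_card_unique_key (T K : finType) (A : {set T}) (P : T -> K -> bool) :
  (forall x, x \in A -> exists k, P x k) ->
  (forall x y k, x \in A -> y \in A -> P x k -> P y k -> x = y) ->
  #|A| <= #|K|.
Proof.
(* An element may admit many keys; [h] picks one, and uniqueness makes the choice injective on
   [A]. *)
move=> exP uniqP; pose h x := [pick k | P x k].
have hP x : x \in A -> exists2 k, h x = Some k & P x k.
  move=> /exP[k Pk]; rewrite /h; case: pickP => [k' Pk'|/(_ k)]; last by rewrite Pk.
  by exists k'.
have h_inj : {in A &, injective h}.
  move=> x y Ax Ay; have [k -> Pk] := hP x Ax; have [k' -> Pk'] := hP y Ay.
  by case=> eq_k; apply: (uniqP x y k) => //; rewrite eq_k.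
rewrite -(card_in_imset h_inj) -cardsT.
apply: (leq_trans _ (leq_imset_card Some _)).
apply/subset_leq_card/subsetP=> _ /imsetP[x /hP[k -> _] ->].
by apply: imset_f.
Qed.

(** Discarding an element of least value never lowers the average, so elements are removed one at a
    time until [j] are left. *)
Lemma exists_heavy_subset (T : finType) (f : T -> nat) (A : {set T}) j :
  j <= #|A| ->
  exists Q : {set T}, [/\ Q \subset A, #|Q| = j &
    j * \sum_(x in A) f x <= #|A| * \sum_(x in Q) f x].
Proof.
move kE: #|A| => k; elim: k A kE => [|k IHk] A cardA le_jk.
  exists A; split => //; first by lia.
  by move: le_jk; rewrite leqn0 => /eqP->.
have [eq_jk | lt_jk] := eqVneq j k.+1.
  by exists A; split => //; rewrite eq_jk.
have [x0 Ax0] : exists x, x \in A by apply/card_gt0P; rewrite cardA.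
have [a Aa min_a] : exists2 a, a \in A & forall x, x \in A -> f a <= f x.
  by case: (arg_minnP f Ax0) => a; exists a.
have cardD : #|A :\ a| = k by move: cardA; rewrite (cardsD1 a) Aa; lia.
have [|Q [sQ cQ sumQ]] := IHk _ cardD; first by lia.
exists Q; split => //; first exact: subset_trans sQ (subsetDl _ _).
have min_sum : k * f a <= \sum_(x in A :\ a) f x.
  rewrite -cardD -sum_nat_const; apply: leq_sum => x.
  by case/setD1P=> _ /min_a.
rewrite (big_setD1 a) //=.
move: min_sum sumQ; set s := \sum_(x in A :\ a) f x; set q := \sum_(x in Q) _.
case: k {IHk cardA cardD} le_jk lt_jk => [|k] le_jk lt_jk min_sum sumQ.
  have -> : j = 0 by lia.
  by [].
(* With [K = k.+1] the size of [A :\ a], scaling by [K] gives [K * j * (f a + s) <= K.+1 * j * s <=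
   K.+1 * K * q], by [min_sum] and then [sumQ]. *)
rewrite -(leq_pmul2l (ltn0Sn k)).
nia.
Qed.

(** * Latin squares and the overlap of two subsquares *)

Lemma latin_square_injective (S : finType) (n : nat) (L : 'M[S]_n) :
  latin_square L -> (forall i, injective (L i)) /\ (forall j, injective (L^~ j)).
Proof.
have symL i j : L i j \in symbols L by apply/imset2P; exists i j.
case/and4P=> _ _ /forallP rowL /forallP colL; split=> [i j j' | j i i'] /= eqL.
  have /cards1P[j0 E] := implyP (forallP (rowL i) (L i j)) (symL i j).
  have: j \in [set j0] by rewrite -E inE.
  have: j' \in [set j0] by rewrite -E inE eqL.
  by rewrite !inE => /eqP-> /eqP->.
have /cards1P[i0 E] := implyP (forallP (colL j) (L i j)) (symL i j).
have: i \in [set i0] by rewrite -E inE.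
have: i' \in [set i0] by rewrite -E inE eqL.
by rewrite !inE => /eqP-> /eqP->.
Qed.

Lemma symbols_submatrix (S : finType) (n : nat) (L : 'M[S]_n) (R C : {set 'I_n}) :
  symbols (submatrix L R C) = [set L i j | i in R, j in C].
Proof.
apply/setP=> s; apply/imset2P/imset2P => [[i j _ _ ->]|[i j Ri Cj ->]].
  by rewrite mxE; exists (enum_val i) (enum_val j); rewrite ?enum_valP.
exists (enum_rank_in Ri i) (enum_rank_in Cj j) => //.
by rewrite mxE !enum_rankK_in.
Qed.

Section Subsquares.

Variables (S : finType) (n : nat) (L : 'M[S]_n) (m : nat).
Hypothesis row_inj : forall i, injective (L i).
Hypothesis col_inj : forall j, injective (L^~ j).

Implicit Types (R C : {set 'I_n}) (i j x y : 'I_n).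

(** Each line of the subsquare carries [m] distinct symbols from a set of size [m], hence all of
    them. *)
Lemma subsquaresP R C : (R, C) \in subsquares L m ->
  exists Sg : {set S},
   [/\ #|R| = m, #|C| = m, #|Sg| = m,
       forall i, i \in R -> [set L i j | j in C] = Sg
     & forall j, j \in C -> [set L i j | i in R] = Sg].
Proof.
rewrite inE /= => /andP[/eqP cR /and4P[/eqP eRC /eqP cS _ _]].
have cC : #|C| = m by rewrite -eRC.
exists (symbols (submatrix L R C)); rewrite symbols_submatrix in cS *.
split=> // [|i Ri|j Cj]; first by rewrite cS.
  apply/eqP; rewrite eqEcard cS card_imset // cR cC leqnn andbT.
  by apply/subsetP=> _ /imsetP[j Cj ->]; apply/imset2P; exists i j.
apply/eqP; rewrite eqEcard cS (card_imset _ (@col_inj j)) leqnn andbT.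
by apply/subsetP=> _ /imsetP[i Ri ->]; apply/imset2P; exists i j.
Qed.

(** Along the shared row, common columns yield common symbols; along a common column, common symbols
    yield common rows. So more than half of the rows and symbols are shared too. *)
Lemma subsquare_eq R C R' C' i :
  (R, C) \in subsquares L m -> (R', C') \in subsquares L m ->
  i \in R -> i \in R' -> m < 2 * #|C :&: C'| -> (R, C) = (R', C').
Proof.
move=> /subsquaresP[Sg [cR cC cS rowS colS]].
move=> /subsquaresP[Sg' [cR' cC' cS' rowS' colS']] Ri Ri' big_C.
have big_S : #|C :&: C'| <= #|Sg :&: Sg'|.
  rewrite -(card_imset _ (@row_inj i)); apply: subset_leq_card.
  apply/subsetP=> _ /imsetP[j /setIP[Cj Cj'] ->].
  by rewrite inE -(rowS i Ri) -(rowS' i Ri') !imset_f.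
have /card_gt0P[j0 /setIP[Cj0 Cj0']] : 0 < #|C :&: C'| by lia.
have big_R : #|Sg :&: Sg'| <= #|R :&: R'|.
  rewrite -(card_imset _ (@col_inj j0)); apply: subset_leq_card.
  apply/subsetP=> s /setIP[]; rewrite -(colS j0 Cj0) -(colS' j0 Cj0').
  case/imsetP=> i1 Ri1 -> /imsetP[i2 Ri2 /col_inj eq_i].
  by apply/imset_f; rewrite inE Ri1 eq_i.
(* A column of [C] outside [C'] would have more than [m / 2] distinct symbols
   in [Sg :\: Sg'], one for each common row. *)
have eq_C : C = C'.
  apply/eqP; rewrite eqEcard cC cC' leqnn andbT; apply/subsetP=> j Cj.
  apply/negPn/negP=> nCj.
  have: #|R :&: R'| <= #|Sg :\: Sg'|.
    rewrite -(card_imset _ (@col_inj j)); apply: subset_leq_card.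
    apply/subsetP=> _ /imsetP[k /setIP[Rk Rk'] ->].
    rewrite inE -(rowS k Rk) imset_f // andbT -(rowS' k Rk').
    by apply: contra nCj => /imsetP[j' Cj' /row_inj ->].
  by have := cardsID Sg' Sg; lia.
congr (_, _) => //.
have eq_S : Sg = Sg' by rewrite -(rowS i Ri) -(rowS' i Ri') eq_C.
apply: (imset_inj (@col_inj j0)).
by rewrite (colS j0 Cj0) (colS' j0 Cj0').
Qed.

(** * Blocks of columns linked by symbols in chosen rows *)

Section Blocks.

Variable rows : {set 'I_n}.

Definition share_symbol x y :=
  [exists i in rows, exists i' in rows, L i x == L i' y].

Lemma share_symbolP x y :
  reflect (exists i i', [/\ i \in rows, i' \in rows & L i x = L i' y])
          (share_symbol x y).
Proof.
apply: (iffP exists_inP) => [[i Ri /exists_inP[i' Ri' /eqP]]|[i [i' [Ri Ri' E]]]].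
  by exists i, i'.
by exists i => //; apply/exists_inP; exists i' => //; apply/eqP.
Qed.

Lemma share_symbol_connect_sym : connect_sym share_symbol.
Proof.
apply: sym_connect_sym => x y.
by apply/share_symbolP/share_symbolP=> [] [i [i' [? ? ?]]]; exists i', i.
Qed.

(** Row [i'] of the subsquare already contains the shared symbol in a column of [C], and it occurs
    only once in that row of [L]. *)
Lemma subsquare_closed R C : (R, C) \in subsquares L m -> rows \subset R ->
  closed share_symbol (mem C).
Proof.
case/subsquaresP=> Sg [_ _ _ rowS _] sR.
apply: (intro_closed share_symbol_connect_sym) => x y /share_symbolP.
case=> i [i' [/(subsetP sR) Ri /(subsetP sR) Ri' E]] Cx.
have: L i' y \in Sg by rewrite -E -(rowS i Ri) imset_f.
by rewrite -(rowS i' Ri') => /imsetP[z Cz /row_inj ->].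
Qed.

(** Components are taken among all columns of [L], so a block depends on [rows] and [x] alone and
    can be recovered without knowing the subsquare. *)
Definition block x : {set 'I_n} := [set y | connect share_symbol x y].

Lemma block_sub R C x : (R, C) \in subsquares L m -> rows \subset R ->
  x \in C -> block x \subset C.
Proof.
move=> sub sR Cx; apply/subsetP=> y; rewrite inE.
by move/(closed_connect (subsquare_closed _ _ sub sR)) => <-.
Qed.

(** The distinct symbols of column [x] in [rows] all reappear in the single row [i0], in distinct
    columns joined to [x]. *)
Lemma card_block_ge R C x : (R, C) \in subsquares L m -> rows \subset R ->
  x \in C -> #|rows| <= #|block x|.
Proof.
case/subsquaresP=> Sg [_ _ _ rowS _] sR Cx.
have [->|[i0 rows_i0]] := set_0Vmem rows; first by rewrite cards0.
rewrite -(card_imset _ (@col_inj x)) -(card_imset (block x) (@row_inj i0)).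
apply/subset_leq_card/subsetP=> _ /imsetP[i rows_i ->].
have Ri := subsetP sR i rows_i; have Ri0 := subsetP sR i0 rows_i0.
have: L i x \in Sg by rewrite -(rowS i Ri) imset_f.
rewrite -(rowS i0 Ri0) => /imsetP[y Cy E]; rewrite E imset_f // inE.
by apply/connect1/share_symbolP; exists i, i0.
Qed.

Lemma exists_majority_blocks R C : 0 < #|rows| ->
  (R, C) \in subsquares L m -> rows \subset R ->
  exists Q : {set 'I_n}, [/\ Q \subset C, #|Q| <= psi m #|rows| &
    m < 2 * #|\bigcup_(x in Q) block x|].
Proof.
move=> t_gt0 sub sR; set t := #|rows| in t_gt0 *.
pose rt := fingraph.root share_symbol.
have symc := share_symbol_connect_sym.
(* One canonical representative for each block of the subsquare. *)
pose A := [set rt x | x in C].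
have sAC : A \subset C.
  apply/subsetP=> _ /imsetP[x Cx ->].
  by rewrite -(closed_connect (subsquare_closed _ _ sub sR) (connect_root _ x)).
have [Sg [cR cC _ rowS _]] := subsquaresP _ _ sub.
have blockE x y : x \in A -> (y \in block x) = (rt y == x).
  case/imsetP=> z _ ->; rewrite inE symc -(root_connect symc).
  by rewrite /rt (root_root symc).
have sum_blocks : \sum_(x in A) #|block x| = #|C|.
  rewrite -sum1_card [RHS](partition_big rt (mem A)) /=; last first.
    by move=> y; apply: imset_f.
  apply: eq_bigr => x Ax; rewrite -sum1_card; apply: eq_bigl => y.
  rewrite -blockE //; apply/idP/andP=> [yx | []] //; split=> //.
  exact: subsetP (block_sub _ _ _ sub sR (subsetP sAC x Ax)) y yx.
have card_A : #|A| * t <= m.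
  rewrite -cC -sum_blocks -sum_nat_const; apply: leq_sum => x Ax.
  exact: (card_block_ge _ _ _ sub sR (subsetP sAC x Ax)).
have m_gt0 : 0 < m by rewrite -cR (leq_trans t_gt0) // subset_leq_card.
(* There may be fewer than [psi m t] blocks; then all are taken. *)
have le_AA : minn (psi m t) #|A| <= #|A| by rewrite geq_minr.
have [Q [sQA cQ heavyQ]] := exists_heavy_subset _ (fun x => #|block x|) A _ le_AA.
exists Q; split; [exact: subset_trans sAC | by rewrite cQ geq_minl |].
have -> : #|\bigcup_(x in Q) block x| = \sum_(x in Q) #|block x|.
  rewrite -sum1_card (partition_big rt (mem Q)) /=; last first.
    move=> y /bigcupP[x Qx yx].
    by have := yx; rewrite blockE ?(subsetP sQA) // => /eqP->.
  apply: eq_bigr => x Qx; rewrite -sum1_card; apply: eq_bigl => y.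
  rewrite -blockE ?(subsetP sQA) //; apply/andP/idP=> [[]|yx] //; split=> //.
  by apply/bigcupP; exists x.
move: heavyQ; rewrite sum_blocks cC; set q := \sum_(x in Q) _.
have A_gt0 : 0 < #|A|.
  rewrite lt0n; apply/negP=> /eqP A0; move: sum_blocks m_gt0.
  by rewrite (cards0_eq A0) big_set0 cC => <-.
have le_A : #|A| <= m %/ t by rewrite leq_divRL.
have [le_Apsi | lt_psiA] := leqP #|A| (psi m t).
  by rewrite leq_pmul2l //; lia.
(* For odd [m], half of the blocks suffice: averaging gives [m <= 2 * q], and parity makes this
   strict. For even [m], strictly more than half of the blocks are needed. *)
move: lt_psiA; rewrite /psi; case: ifPn => [odd_m | _] _ heavyQ.
  have: #|A| <= 2 * uphalf (m %/ t) by lia.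
  move=> A_psi; have: m <= 2 * q by nia.
  by lia.
have: #|A| < 2 * (m %/ (2 * t) + 1).
  by rewrite [2 * t]mulnC divnMA; lia.
by move=> A_psi; nia.
Qed.

End Blocks.

(** * Counting subsquares by keys *)

Lemma card_subsquares_le (t : nat) : 0 < t -> t <= m ->
  #|subsquares L m| <= n ^ (psi m t + t).
Proof.
move=> t_gt0 le_tm.
(* Keys are functions rather than sets: repetitions are allowed and the number of keys is exactly
   the required power of [n]. *)
pose rows (r : {ffun 'I_t -> 'I_n}) := [set r a | a in 'I_t].
pose key_cols (k : {ffun 'I_(psi m t) -> 'I_n} * {ffun 'I_t -> 'I_n}) :=
  \bigcup_b block (rows k.2) (k.1 b).
pose key_of (RC : {set 'I_n} * {set 'I_n}) k :=
  [&& rows k.2 \subset RC.1, key_cols k \subset RC.2 & m < 2 * #|key_cols k|].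
have -> : n ^ (psi m t + t) =
    #|{: {ffun 'I_(psi m t) -> 'I_n} * {ffun 'I_t -> 'I_n}}|.
  by rewrite card_prod !card_ffun !card_ord expnD.
apply: (leq_card_unique_key _ _ _ key_of) => [[R C] sub|]; last first.
  move=> [R C] [R' C'] k sub sub' /and3P[/= sR sC big] /and3P[/= sR' sC' _].
  have r0 : k.2 (Ordinal t_gt0) \in rows k.2 by apply: imset_f.
  apply: (subsquare_eq _ _ _ _ _ sub sub' (subsetP sR _ r0) (subsetP sR' _ r0)).
  apply: (leq_trans big); rewrite leq_mul2l /=; apply: subset_leq_card.
  by rewrite subsetI sC.
have [_ [cR cC _ _ _]] := subsquaresP _ _ sub.
have le_tR : t <= #|R| by rewrite cR.
pose r : {ffun 'I_t -> 'I_n} := [ffun a => enum_val (widen_ord le_tR a)].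
have r_inj : injective r.
  by move=> a b; rewrite !ffunE => /enum_val_inj/(congr1 val) /= /val_inj.
have card_rows : #|rows r| = t by rewrite card_imset // card_ord.
have sR : rows r \subset R.
  by apply/subsetP=> _ /imsetP[a _ ->]; rewrite ffunE enum_valP.
have rows_gt0 : 0 < #|rows r| by rewrite card_rows.
have [Q [sQC]] := exists_majority_blocks _ _ _ rows_gt0 sub sR.
rewrite card_rows => cQ bigQ.
have /card_gt0P[x0 Cx0] : 0 < #|C| by lia.
(* When [Q] is too small, the list is padded with [x0], a column of [C], so that every listed block
   stays inside [C]. *)
pose c : {ffun 'I_(psi m t) -> 'I_n} := [ffun b : 'I__ => nth x0 (enum Q) b].
have Cc b : c b \in C.
  rewrite ffunE; have [lt_b | le_b] := ltnP b (size (enum Q)).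
    by apply: (subsetP sQC); rewrite -mem_enum mem_nth.
  by rewrite nth_default.
exists (c, r); apply/and3P; split=> //=.
  by apply/bigcupsP=> b _; apply: (block_sub _ _ _ _ sub sR).
apply: (leq_trans bigQ); rewrite leq_mul2l /=; apply: subset_leq_card.
apply/bigcupsP=> x Qx.
have lt_x : index x (enum Q) < psi m t.
  by apply: leq_trans cQ; rewrite cardE index_mem mem_enum.
apply: (bigcup_max (Ordinal lt_x)) => //=.
by rewrite ffunE /= nth_index // mem_enum.
Qed.

End Subsquares.

Theorem theorem2p2 (m t : nat) (m_gt0 : 0 < m) (t_gt0 : 0 < t) (le_tm : t <= m) :
  exists C : nat, forall n : nat, m <= n ->
    forall (S : finType) (L : 'M[S]_n), latin_square L ->
      #|subsquares L m| <= C * n ^ (psi m t + t).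
Proof.
(* The number of keys is itself the bound, so the constant is 1. *)
exists 1 => n _ S L /latin_square_injective[row_inj col_inj].
by rewrite mul1n; apply: card_subsquares_le.
Qed.
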